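(* Let $\mathcal P\subset\mathbb Q[x_1,\dots,x_n]$ be a zero-dimensional polynomial system, and let the positive rational numbers $d_1,\dots,d_n$, $r_1,\dots,r_n$, $s_1,\dots,s_{n-1}$ satisfy conditions (C1), (C2), (C3) below. Let $T_1,\dots,T_n$ be the univariate polynomials defined below. Then $(T_1,\dots,T_n,\ s_1,\dots,s_{n-1},\ d_1,\dots,d_{n-1})$ is a linear univariate representation (LUR) for $\mathcal P$, i.e. the set of roots of this LUR equals $V_{\mathbb C}(\mathcal P)$.
   Context: Standing setup. $\mathcal P=\{f_1,\dots,f_s\}\subset\mathbb Q[x_1,\dots,x_n]$ is zero-dimensional (finitely many common complex zeros). For $i=1,\dots,n$ let $\mathcal I_i=(\mathcal P)\cap\mathbb Q[x_1,\dots,x_i]$ and let $V_{\mathbb C}(\mathcal I_i)\subset\mathbb C^i$ be its set of common complex zeros; $V_{\mathbb C}(\mathcal I_0)$ consists of the single empty tuple. Throughout, for a complex number $c=u+v\mathrm{i}$ ($u,v\in\mathbb R$) we use the norm $|c|=\max\{|u|,|v|\}$. Put $s_0=1$, $d_0=+\infty$. For $i=1,\dots,n$ let $D_i=\min\{\tfrac12|\alpha-\beta| : \eta\in V_{\mathbb C}(\mathcal I_{i-1}),\ (\eta,\alpha),(\eta,\beta)\in V_{\mathbb C}(\mathcal I_i),\ \alpha\neq\beta\}$ (with $D_i=+\infty$ if this set is empty). Conditions: (C1) $d_i<\min\{D_i,\ d_{i-1}/(2s_{i-1})\}$ for $i=1,\dots,n$; (C2) $r_i>2\max\{|\alpha_i|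 : (\alpha_1,\dots,\alpha_i)\in V_{\mathbb C}(\mathcal I_i)\}$ for $i=1,\dots,n$; (C3) $s_i\le d_i/r_{i+1}$ for $i=1,\dots,n-1$. For $i=1,\dots,n$, $T_i(x)\in\mathbb Q[x]$ is a generator of the principal ideal $\big(\mathcal I_i\cup\{x-x_1-s_1x_2-\cdots-s_1\cdots s_{i-1}x_i\}\big)\cap\mathbb Q[x]$, the ideal being taken in $\mathbb Q[x_1,\dots,x_i,x]$ with $x$ a new variable. An LUR is a tuple $(T_1,\dots,T_n,\ s_1,\dots,s_{n-1},\ d_1,\dots,d_{n-1})$ with $T_i\in\mathbb Q[x]$ and $s_i,d_i$ positive rationals; its roots are the points $\big(\alpha_1,\frac{\alpha_2-\alpha_1}{s_1},\dots,\frac{\alpha_n-\alpha_{n-1}}{s_1\cdots s_{n-1}}\big)$ where $T_i(\alpha_i)=0$ for $i=1,\dots,n$ and $|\alpha_{i+1}-\alpha_i|<s_1\cdots s_{i-1}d_i$ for $i=1,\dots,n-1$. It is an LUR for $\mathcal P$ if its set of roots equals $V_{\mathbb C}(\mathcal P)$. *)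

(* Defs.v *)
From HB Require Import structures.
From mathcomp Require Import all_boot all_order all_algebra.
Set Implicit Arguments. Unset Strict Implicit. Unset Printing Implicit Defensive.
Import Order.TTheory GRing.Theory Num.Theory.
Local Open Scope ring_scope.

(* Multivariate polynomials over Q in n variables x_1..x_n, as iterated
   univariate polynomials: mp 0 = Q, mp (m+1) = (mp m)[x_{m+1}].
   Variables are 0-indexed internally: variable j (j < n) is x_{j+1}. *)
Fixpoint mp (n : nat) : idomainType :=
  match n with
  | 0 => rat
  | m.+1 => {poly mp m}
  end.

Fixpoint cst (n : nat) : rat -> mp n :=
  match n return rat -> mp n with
  | 0 => fun q => q
  | m.+1 => fun q => (cst m q)%:P
  end.

(* the variable x_{j+1} of mp n (for j < n; junk 0 otherwise) *)
Fixpoint var (n j : nat) : mp n :=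
  match n return mp n with
  | 0 => 0
  | m.+1 => if j == m then 'X else (var m j)%:P
  end.

Fixpoint onlyIn (A : pred nat) (n : nat) : mp n -> bool :=
  match n return mp n -> bool with
  | 0 => fun _ => true
  | m.+1 => fun h => (A m || (size h <= 1)%N) && all (@onlyIn A m) h
  end.

Fixpoint eval (C : numClosedFieldType) (a : nat -> C) (n : nat) : mp n -> C :=
  match n return mp n -> C with
  | 0 => fun q => ratr q
  | m.+1 => fun h => \sum_(k < size h) @eval C a m h`_k * a m ^+ k
  end.

(* x lies in the ideal generated by S, with coefficients restricted to Coef
   (used to take ideals inside the subring defined by Coef) *)
Definition in_ideal (R : comNzRingType) (Coef : pred R) (S : R -> Prop) (x : R) :=
  exists (m : nat) (h g : 'I_m -> R),
    (forall k, Coef (h k)) /\ (forall k, S (g k)) /\ x = \sum_(k < m) h k * g k.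

Definition elimI (n : nat) (P : seq (mp n)) (i : nat) (g : mp n) : Prop :=
  @onlyIn (fun j => (j < i)%N) n g /\ in_ideal predT (fun f => f \in P) g.

Definition inV (C : numClosedFieldType) (n : nat) (P : seq (mp n)) (i : nat)
  (a : nat -> C) : Prop :=
  forall g, elimI P i g -> eval a g = 0.

Definition isZero (C : numClosedFieldType) (n : nat) (P : seq (mp n))
  (a : nat -> C) : Prop :=
  forall f, f \in P -> eval a f = 0.

Definition zeroDim (C : numClosedFieldType) (n : nat) (P : seq (mp n)) : Prop :=
  exists (m : nat) (q : 'I_m -> nat -> C),
    forall a, isZero P a -> exists k, forall j, (j < n)%N -> a j = q k j.

Definition normInf (C : numClosedFieldType) (c : C) : C :=
  Num.max `|'Re c| `|'Im c|.

Definition sprod (s : nat -> rat) (j : nat) : rat := \prod_(1 <= k < j) s k.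

(* the linear form x - x_1 - s_1 x_2 - ... - s_1...s_{i-1} x_i in
   Q[x_1..x_n, x] = mp (n+1), where x is the variable of index n *)
Definition linForm (n : nat) (s : nat -> rat) (i : nat) : mp n.+1 :=
  @var n.+1 n - \sum_(j < i) @cst n.+1 (sprod s j.+1) * @var n.+1 j.

Definition Jideal (n : nat) (P : seq (mp n)) (s : nat -> rat) (i : nat)
  (h : mp n.+1) : Prop :=
  in_ideal (@onlyIn (fun j => (j < i)%N || (j == n)) n.+1)
    (fun g => (exists g0, elimI P i g0 /\ g = g0%:P) \/ g = linForm n s i) h.

(* T generates (I_i ∪ {x - ...}) ∩ Q[x]; Q[x] is embedded in mp (n+1)
   with x the variable of index n *)
Definition isGenT (n : nat) (P : seq (mp n)) (s : nat -> rat) (i : nat)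
  (T : {poly rat}) : Prop :=
  forall t : {poly rat}, Jideal P s i (map_poly (@cst n) t) <-> (T %| t)%R.

(* roots of the LUR (T_1..T_n, s_1..s_{n-1}, d_1..d_{n-1}); T, s, d are
   1-indexed; the point p is 0-indexed (p j = coordinate j+1) *)
Definition isLURroot (C : numClosedFieldType) (n : nat) (T : nat -> {poly rat})
  (s d : nat -> rat) (p : nat -> C) : Prop :=
  exists alpha : nat -> C,
    (forall i, (1 <= i <= n)%N -> root (map_poly ratr (T i)) (alpha i)) /\
    (forall i, (1 <= i < n)%N ->
       normInf (alpha i.+1 - alpha i) < ratr (sprod s i * d i)) /\
    (forall j, (1 <= j <= n)%N ->
       p j.-1 = if j == 1%N then alpha 1%N
                else (alpha j - alpha j.-1) / ratr (sprod s j)).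

(* Main.v *)
Require Import Defs.
From HB Require Import structures.
From mathcomp Require Import all_boot all_order all_algebra.
From mathcomp Require Import boolp classical_sets.
From mathcomp Require Import ring.
Import Order.TTheory GRing.Theory Num.Theory.
Local Open Scope ring_scope.

(** Put [u_i = x_1 + s_1 x_2 + ... + s_1...s_{i-1} x_i].  The heart of the proof
    is that every complex root [x0] of [T_i] is the value of [u_i] at a zero of
    the whole system.  No [t(u_i)] with [t(x0) <> 0] lies in the ideal of the
    system, so a prime [p] above that ideal avoids all of them.  Adjoin a bottom
    variable [y] for [u_i] and climb the tower [Q[y], Q[y][x_1], ...] one
    variable at a time: a value of [y] killing the contraction of [p] to [Q[y]],
    and not killing some fixed [h1] outside it, extends to a zero of [p].  If the
    contraction were zero, [u_i] would take infinitely many values on the finite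
    zero set; hence it is nonzero, so it consists of all polynomials vanishing at
    [x0], and [y = x0] extends.

    Writing [e_i = s_1...s_{i-1} d_i], conditions (C2) and (C3) bound the term
    [s_1...s_i x_{i+1}] by [e_i / 2] on zeros, while (C1) makes the values of
    [u_i] at zeros differing in the first [i] coordinates more than [2 e_i]
    apart.  So the inequalities of an LUR root force the zeros above
    consecutive [alpha_i] to agree, and a single zero gives all [alpha_i]. *)

(** * Prime ideals *)

Record is_ideal {R : comNzRingType} (p : R -> Prop) : Prop := IsIdeal {
  ideal0 : p 0;
  idealD : forall x y, p x -> p y -> p (x + y);
  idealM : forall x y, p y -> p (x * y) }.

Record is_prime {R : comNzRingType} (p : R -> Prop) : Prop := IsPrime {
  prime_is_ideal : is_ideal p;
  prime1 : ~ p 1;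
  primeM : forall x y, p (x * y) -> p x \/ p y }.

Section IdealTheory.
Context {R : comNzRingType} {p : R -> Prop}.

Lemma idealN (pI : is_ideal p) x : p x -> p (- x).
Proof. by rewrite -mulN1r; apply: idealM. Qed.

Lemma idealB (pI : is_ideal p) x y : p x -> p y -> p (x - y).
Proof. by move=> px py; apply: idealD => //; apply: idealN. Qed.

Lemma ideal_sum (pI : is_ideal p) (I : Type) (r : seq I) (Q : pred I) (F : I -> R) :
  (forall i, Q i -> p (F i)) -> p (\sum_(i <- r | Q i) F i).
Proof. by apply: big_ind; [apply: ideal0|apply: idealD]. Qed.

Lemma primeX (pP : is_prime p) x n : p (x ^+ n) -> p x.
Proof.
elim: n => [|n IH]; first by rewrite expr0 => /(prime1 _ pP).
by rewrite exprS => /(primeM _ pP)[].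
Qed.

End IdealTheory.

Lemma in_ideal_is_ideal {R : comNzRingType} (S : R -> Prop) :
  is_ideal (in_ideal predT S).
Proof.
split.
- exists 0%N, (fun=> 0), (fun=> 0); split=> //; split; first by case.
  by rewrite big_ord0.
- move=> x y [m [h [g [_ [Sg ->]]]]] [m' [h' [g' [_ [Sg' ->]]]]].
  exists (m + m')%N, (fun k => match split k with inl i => h i | inr i => h' i end),
    (fun k => match split k with inl i => g i | inr i => g' i end).
  split=> //; split; first by move=> k; case: (split k).
  rewrite big_split_ord /=; congr (_ + _); apply: eq_bigr => i _.
    by case: (split (lshift m' i)) (splitK (lshift m' i)) => j /=;
      [move/lshift_inj->|move/eqP; rewrite eq_rlshift].
  by case: (split (rshift m i)) (splitK (rshift m i)) => j /=;
      [move/eqP; rewrite eq_lrshift|move/rshift_inj->].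
- move=> x y [m [h [g [_ [Sg ->]]]]].
  exists m, (fun k => x * h k), g; split=> //; split=> //.
  by rewrite mulr_sumr; apply: eq_bigr => i _; rewrite mulrA.
Qed.

Lemma in_ideal_gen {R : comNzRingType} (S : R -> Prop) x : S x -> in_ideal predT S x.
Proof.
move=> Sx; exists 1%N, (fun=> 1), (fun=> x); split=> //; split=> //.
by rewrite big_ord1 mul1r.
Qed.

Section PrimeAvoidance.
Context {R : comNzRingType} (I M : R -> Prop).
Hypothesis idI : is_ideal I.
Hypothesis M1 : M 1.
Hypothesis MM : forall x y, M x -> M y -> M (x * y).
Hypothesis IM : forall x, I x -> ~ M x.

(** Krull's argument: let [A] be maximal among the ideals that contain [I] and avoid [M]. If [x] and
    [y] are outside [A], then [A + (x)] and [A + (y)] both meet [M]. The product of the two meeting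
    elements is in [M], and it would be in [A] if [x * y] were. *)
Lemma prime_avoiding :
  exists p, [/\ is_prime p, forall x, I x -> p x & forall x, p x -> ~ M x].
Proof.
(* The empty set is admitted so that the empty chain has an upper bound. *)
pose good (A : set R) := is_ideal A /\ (forall x, I x -> A x) /\ (forall x, A x -> ~ M x).
have [|A [Agood Amax]] := @Zorn_bigcup R (fun A => A = set0 \/ good A).
  move=> F Fgood Ftot.
  have mem_good X x : F X -> X x -> good X.
    by move=> FX Xx; case: (Fgood X FX) Xx => // ->.
  have [[X [FX [x Xx]]]|noX] := pselect (exists X, F X /\ exists x, X x); last first.
    left; rewrite -subset0 => x [X FX Xx]; apply: noX.
    by exists X; split=> //; exists x.
  right; have [Xid [IX _]] := mem_good X x FX Xx; split; [split|split].
  - by exists X => //; apply: ideal0 Xid.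
  - move=> y z [Y FY Yy] [Z FZ Zz].
    have [Yid _] := mem_good _ _ FY Yy; have [Zid _] := mem_good _ _ FZ Zz.
    case: (Ftot Y Z FY FZ) => sub.
      by exists Z => //; apply: (idealD _ Zid) => //; apply: sub.
    by exists Y => //; apply: (idealD _ Yid) => //; apply: sub.
  - move=> y z [Z FZ Zz]; have [Zid _] := mem_good _ _ FZ Zz.
    by exists Z => //; apply: (idealM _ Zid).
  - by move=> y Iy; exists X => //; apply: IX.
  - by move=> y [Y FY Yy]; have [_ [_]] := mem_good _ _ FY Yy; apply.
have {Agood} [Aid [IA AM]] : good A.
  case: Agood => // A0; exfalso; apply: (Amax I); last by right.
  rewrite A0; split; [exact: sub0set|]; move=> sub.
  by have := sub _ (ideal0 _ idI).
have meets x : ~ A x -> exists a b, A a /\ M (a + b * x).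
  move=> nAx; apply: contrapT => nmeet.
  apply: (Amax (fun y => exists a b, A a /\ y = a + b * x)).
    split; first by move=> a Aa; exists a, 0; rewrite mul0r addr0.
    move=> sub; apply: nAx; apply: sub.
    by exists 0, 1; rewrite mul1r add0r; split=> //; apply: ideal0 Aid.
  right; split; [split|split].
  - by exists 0, 0; rewrite mul0r addr0; split=> //; apply: ideal0 Aid.
  - move=> _ _ [a [b [Aa ->]]] [a' [b' [Aa' ->]]]; exists (a + a'), (b + b').
    by rewrite mulrDl addrACA; split=> //; apply: (idealD _ Aid).
  - move=> z _ [a [b [Aa ->]]]; exists (z * a), (z * b).
    by rewrite mulrDr mulrA; split=> //; apply: (idealM _ Aid).
  - by move=> y /IA Ay; exists y, 0; rewrite mul0r addr0.
  - by move=> _ [a [b [Aa ->]]] Mab; apply: nmeet; exists a, b.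
exists A; split=> //; split=> //; first by move=> A1; apply: AM A1 M1.
move=> x y Axy; have [Ax|/meets[a [b [Aa Mx]]]] := pselect (A x); [by left|right].
apply: contrapT => /meets[a' [b' [Aa' My]]].
apply: AM (MM _ _ Mx My); rewrite mulrDl mulrDr (mulrC (b * x)) (mulrC a).
apply: (idealD _ Aid); last first.
  rewrite mulrDl; apply: (idealD _ Aid).
    by rewrite mulrC; apply: (idealM _ Aid).
  by rewrite mulrACA mulrC (mulrC y x) mulrC; apply: (idealM _ Aid).
by apply: (idealD _ Aid); [|rewrite mulrC]; apply: (idealM _ Aid).
Qed.

End PrimeAvoidance.

(** * Extending a point by one variable, modulo a prime ideal *)

Lemma min_size {R : nzRingType} (Q : {poly R} -> Prop) f0 : Q f0 ->
  exists2 f, Q f & forall f', Q f' -> (size f <= size f')%N.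
Proof.
move=> Qf0.
have ex : exists k, `[< exists2 f, Q f & size f = k >].
  by exists (size f0); apply/asboolP; exists f0.
case: (ex_minnP ex) => k /asboolP[f Qf <-] kmin; exists f => // f' Qf'.
by apply: kmin; apply/asboolP; exists f'.
Qed.

Lemma size_drop_lead {R : nzRingType} (f : {poly R}) : f != 0 ->
  (size (f - lead_coef f *: 'X^((size f).-1))%R < size f)%N.
Proof.
move=> nz_f; have sz_f : (0 < size f)%N by rewrite size_poly_gt0.
rewrite -(prednK sz_f) ltnS; apply/leq_sizeP => j lej.
rewrite coefB coefZ coefXn; move: lej; rewrite leq_eqVlt => /orP[/eqP<-|ltj].
  by rewrite eqxx mulr1 lead_coefE subrr.
by rewrite gtn_eqF // mulr0 subr0 nth_default // -(prednK sz_f).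
Qed.

(** In characteristic 0 the integers below [size f] are distinct, one more than the possible
    roots. *)
Lemma nonroot {C : numClosedFieldType} (f : {poly C}) : f != 0 -> exists c, f.[c] != 0.
Proof.
move=> nz_f; apply: contrapT => allroot.
pose rs : seq C := [seq i%:R | i <- iota 0 (size f)].
have := @max_poly_roots _ f rs nz_f; rewrite size_map size_iota ltnn => H.
suff: false by []; apply: H.
  apply/allP => x _; rewrite rootE; apply/negPn/negP => nz; apply: allroot.
  by exists x.
rewrite map_inj_uniq ?iota_uniq // => i j /eqP.
by rewrite eqr_nat => /eqP.
Qed.

Section OneStep.
Context {R : idomainType} (p : {poly R} -> Prop).
Hypothesis pP : is_prime p.
Let pI := prime_is_ideal _ pP.

Lemma contraction_prime : is_prime (fun r : R => p r%:P).
Proof.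
split; [split|..].
- by rewrite polyC0; apply: ideal0 pI.
- by move=> x y px py; rewrite polyCD; apply: (idealD _ pI).
- by move=> x y py; rewrite polyCM; apply: (idealM _ pI).
- by rewrite polyC1; apply: prime1 pP.
- by move=> x y; rewrite polyCM; apply: primeM pP _ _.
Qed.

Lemma ideal_coefs (f : {poly R}) : (forall k, p (f`_k)%:P) -> p f.
Proof.
move=> pf; rewrite -[f]coefK poly_def; apply: (ideal_sum pI) => i _.
by rewrite -mul_polyC mulrC; apply: (idealM _ pI).
Qed.

(** Once the leading coefficient is in [p], removing the leading term leaves a shorter element of
    [p], so induction on the size applies. *)
Lemma coefs_in_ideal m :
  (forall f, p f -> (size f <= m)%N -> p (lead_coef f)%:P) ->
  forall f, p f -> (size f <= m)%N -> forall k, p (f`_k)%:P.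
Proof.
move=> lead_p f; have [l] := ubnP (size f).
elim: l f => // l IH f; rewrite ltnS => szl pf szm k.
have [->|nz_f] := eqVneq f 0; first by rewrite coef0 polyC0; apply: ideal0 pI.
have lt := size_drop_lead f nz_f; have plf := lead_p f pf szm.
set f' := f - _ in lt.
have pX : p (lead_coef f *: 'X^((size f).-1)).
  by rewrite -mul_polyC mulrC; apply: (idealM _ pI).
have pf' : p f' by apply: (idealB pI).
have := IH f' (leq_trans lt szl) pf' (leq_trans (ltnW lt) szm) k.
have -> : f = f' + lead_coef f *: 'X^((size f).-1) by rewrite subrK.
rewrite coefD coefZ coefXn polyCD => pk; apply: (idealD _ pI) => //.
by rewrite polyCM mulrC; apply: (idealM _ pI).
Qed.

(* In the algebraic case [g] is a minimal polynomial over the fraction field of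
   the contraction, so it is coprime to [h]. *)
Lemma contraction_of_adjoin g h : p g -> ~ p (lead_coef g)%:P ->
  (forall f, p f -> ~ p (lead_coef f)%:P -> (size g <= size f)%N) ->
  ~ p h -> exists r e w, [/\ ~ p r%:P, p e & r%:P = e + w * h].
Proof.
move=> pg nplg gmin nph.
(* A shortest element [f] of [p + (h)] outside [p] will turn out to be a constant; it is the
   required [r]. *)
pose Q f := ~ p f /\ exists e w, p e /\ f = e + w * h.
have [|f [npf [e [w [pe deff]]]] fmin] := @min_size _ Q h.
  by split=> //; exists 0, 1; rewrite mul1r add0r; split=> //; apply: ideal0 pI.
have mulf a : a * f = a * e + a * w * h by rewrite deff mulrDr mulrA.
have nz_f : f != 0 by apply: contra_notN npf => /eqP->; apply: ideal0 pI.
have nplf : ~ p (lead_coef f)%:P.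
  move=> plf; have := size_drop_lead f nz_f; set f' := f - _.
  have pX : p (lead_coef f *: 'X^((size f).-1)).
    by rewrite -mul_polyC mulrC; apply: (idealM _ pI).
  suff /fmin : Q f' by case: ltnP.
  split.
    move=> pf'; apply: npf; rewrite -(subrK (lead_coef f *: 'X^((size f).-1)) f).
    exact: (idealD _ pI).
  exists (e - lead_coef f *: 'X^((size f).-1)), w; split; first exact: (idealB pI).
  by rewrite /f' deff addrAC.
have nz_g : g != 0.
  by apply: contra_notN nplg => /eqP->; rewrite lead_coef0 polyC0; apply: ideal0 pI.
(* Otherwise the pseudo-remainder of [f] by [g] is a shorter element of [Q]: it stays outside [p]
   because neither [f] nor [lead_coef g] lies in the prime. *)
have sz_fg : (size f <= size g)%N.
  rewrite leqNgt; apply/negP => lt_gf.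
  have eqn := Pdiv.Idomain.divp_eq f g; set k := scalp f g in eqn.
  have lt_rem : (size (f %% g)%R < size g)%N by rewrite Pdiv.Idomain.ltn_modp.
  suff /fmin : Q (f %% g) by rewrite leqNgt (ltn_trans lt_rem lt_gf).
  have remE : f %% g = (lead_coef g ^+ k)%:P * f - (f %/ g) * g.
    by rewrite mul_polyC eqn addrAC subrr add0r.
  split.
    move=> pr; have : p ((lead_coef g ^+ k)%:P * f).
      by rewrite mul_polyC eqn; apply: (idealD _ pI) => //; apply: (idealM _ pI).
    case/(primeM _ pP) => //; rewrite polyC_exp => /(primeX pP); exact: nplg.
  exists ((lead_coef g ^+ k)%:P * e - (f %/ g) * g), ((lead_coef g ^+ k)%:P * w).
  split; first by apply: (idealB pI); apply: (idealM _ pI).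
  by rewrite remE mulf addrAC.
have eqn := Pdiv.Idomain.divp_eq g f; set k := scalp g f in eqn.
have lt_rem : (size (g %% f)%R < size f)%N by rewrite Pdiv.Idomain.ltn_modp.
have remE : g %% f = (lead_coef f ^+ k)%:P * g - (g %/ f) * f.
  by rewrite mul_polyC eqn addrAC subrr add0r.
(* This pseudo-remainder is in [p + (h)] and shorter than [f], so minimality of [f] puts it in [p];
   primality then puts the quotient in [p]. *)
have prem : p (g %% f).
  apply: contrapT => nprem; suff /fmin : Q (g %% f) by rewrite leqNgt lt_rem.
  split=> //; exists ((lead_coef f ^+ k)%:P * g - (g %/ f) * e), (- (g %/ f) * w).
  split; first by apply: (idealB pI); apply: (idealM _ pI).
  by rewrite remE mulf opprD !mulNr addrA.
have quoE : (g %/ f) * f = (lead_coef f ^+ k)%:P * g - g %% f.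
  by rewrite mul_polyC eqn addrK.
have pquo : p (g %/ f).
  have : p ((g %/ f) * f) by rewrite quoE; apply: (idealB pI) => //; apply: (idealM _ pI).
  by case/(primeM _ pP).
have nz_lk : lead_coef f ^+ k != 0 by rewrite expf_neq0 // lead_coef_eq0.
have sz_lg : size ((lead_coef f ^+ k)%:P * g) = size g by rewrite mul_polyC size_scale.
have lt2 : (size (- (g %% f)%R) < size ((lead_coef f ^+ k)%:P * g)%R)%N.
  by rewrite size_polyN sz_lg (leq_trans lt_rem).
have npq : ~ p (lead_coef (g %/ f))%:P.
  move=> plq; have : p (lead_coef ((g %/ f) * f))%:P.
    by rewrite lead_coefM polyCM mulrC; apply: (idealM _ pI).
  rewrite quoE lead_coefDl // lead_coefM lead_coefC polyCM => /(primeM _ pP)[|//].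
  by rewrite polyC_exp => /(primeX pP).
have nz_q : g %/ f != 0.
  by apply: contra_notN npq => /eqP->; rewrite lead_coef0 polyC0; apply: ideal0 pI.
(* The quotient is at least as long as [g] by minimality of [g], while its product with [f] has the
   size of [g]; hence [f] is constant. *)
have sz_q := gmin _ pquo npq.
have : size ((g %/ f) * f) = size g by rewrite quoE size_polyDl.
rewrite size_mul // => sz_qf.
have sz_f1 : (size f <= 1)%N.
  rewrite leqNgt; apply/negP => sz_f2; move: sz_qf => /eqP.
  by case: (size f) sz_f2 => [|[|m]] // _; rewrite !addnS /= => /eqP sz_qf;
    move: sz_q; rewrite -sz_qf -addSn ltnNge leq_addr.
exists f`_0, e, w; split=> //; last by rewrite -size1_polyC.
by rewrite -size1_polyC.
Qed.

(** If all coefficients of elements of [p] lie in the contraction, any [c] outside the roots of the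
    image of [h] works, and [h0] is a coefficient of [h] outside the contraction. Otherwise [c] is a
    root of the image of a shortest [g] in [p] with leading coefficient outside the contraction. *)
Lemma extend_point {C : numClosedFieldType} h : ~ p h ->
  exists2 h0 : R, ~ p h0%:P &
    forall phi : {rmorphism R -> C}, (forall r, p r%:P -> phi r = 0) -> phi h0 != 0 ->
    exists2 c, forall f, p f -> (map_poly phi f).[c] = 0 & (map_poly phi h).[c] != 0.
Proof.
move=> nph.
have [[g0 pg0]|algebraic] := pselect (exists g, p g /\ ~ p (lead_coef g)%:P); last first.
  have pcoef f k : p f -> p (f`_k)%:P.
    move=> pf; apply: (@coefs_in_ideal (size f)) => // f' pf' _.
    by apply: contrapT => np; apply: algebraic; exists f'.
  have [k npk] : exists k, ~ p (h`_k)%:P.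
    by apply: contrapT => H; apply/nph/ideal_coefs => k; apply: contrapT => npk;
      apply: H; exists k.
  exists h`_k => // phi phi0 nz.
  have [|c nzc] := nonroot (map_poly phi h).
    by apply: contraNneq nz => eq0; rewrite -coef_map eq0 coef0.
  exists c => // f pf; have -> : map_poly phi f = 0; last by rewrite horner0.
  by apply/polyP => j; rewrite coef_map coef0; apply: phi0; apply: pcoef.
have [g [pg nplg] gmin] := @min_size _ (fun g => p g /\ ~ p (lead_coef g)%:P) g0 pg0.
have [|r [e [w [npr pe rE]]]] := contraction_of_adjoin g h pg nplg _ nph.
  by move=> f pf nplf; apply: gmin.
(* The first factor keeps the image of [g] nonconstant and lets powers of [lead_coef g] be cancelled
   after pseudo-division; the second, being [e + w * h], keeps [h] from vanishing at [c]. *)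
exists (lead_coef g * r).
  by rewrite polyCM => /(primeM _ pP)[].
move=> phi phi0; rewrite rmorphM mulf_eq0 negb_or => /andP[nz_lg nz_r].
have sz_g : (1 < size g)%N.
  rewrite ltnNge; apply/negP => sz1; apply: nplg.
  by rewrite (size1_polyC sz1) lead_coefC -size1_polyC.
have [c rootc] : exists c, root (map_poly phi g) c.
  by apply/closed_rootP; rewrite size_map_poly_id0 // gtn_eqF.
have vanish f : p f -> (map_poly phi f).[c] = 0.
  move=> pf; have eqn := Pdiv.Idomain.divp_eq f g; set k := scalp f g in eqn.
  have nz_g : g != 0 by rewrite -size_poly_gt0 (ltn_trans _ sz_g).
  have lt_rem : (size (f %% g)%R < size g)%N by rewrite Pdiv.Idomain.ltn_modp.
  have prem : p (f %% g).
    have -> : f %% g = (lead_coef g ^+ k)%:P * f - (f %/ g) * g.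
      by rewrite mul_polyC eqn addrAC subrr add0r.
    by apply: (idealB pI); apply: (idealM _ pI).
  have rem0 : map_poly phi (f %% g) = 0.
    apply/polyP => j; rewrite coef_map coef0; apply: phi0.
    (* Elements of [p] shorter than [g] have leading coefficient in the contraction, by minimality
       of [g]. *)
    apply: (@coefs_in_ideal (size (f %% g)%R)) => // f' pf' sz_f'.
    apply: contrapT => nplf'; have := gmin f' (conj pf' nplf').
    by rewrite leqNgt (leq_ltn_trans sz_f' lt_rem).
  have := congr1 (fun q => (map_poly phi q).[c]) eqn.
  rewrite map_polyZ rmorphD rmorphM /= rem0 addr0 hornerZ hornerM (rootP rootc) mulr0.
  by move/eqP; rewrite mulf_eq0 rmorphXn expf_eq0 (negPf nz_lg) andbF /= => /eqP.
exists c => //; apply: contraNneq nz_r => hc0.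
have := congr1 (fun q => (map_poly phi q).[c]) rE.
by rewrite map_polyC hornerC rmorphD rmorphM /= hornerD hornerM hc0 mulr0 addr0 vanish // => ->.
Qed.

End OneStep.

(** * Extending zeros along the tower of polynomial rings *)

Section Evaluation.
Context {B : comNzRingType} (iota : {rmorphism rat -> B}) (a : nat -> B).

Definition ev_step {m} (f : {rmorphism mp m -> B}) : {rmorphism mp m.+1 -> B} :=
  GRing.RMorphism.clone _ _ (@horner_morph (mp m) B f (a m) (fun x => mulrC _ _)) _.

(** A bundled morphism into any commutative ring: it is [eval] when [B] is [C], and polynomial
    substitution when [B] is some [mp k]. *)
Fixpoint ev (n : nat) : {rmorphism mp n -> B} :=
  match n with 0 => iota | m.+1 => ev_step (ev m) end.

Lemma evS m (h : mp m.+1) : ev m.+1 h = (map_poly (ev m) h).[a m].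
Proof. by []. Qed.

Lemma evC m (h : mp m) : ev m.+1 (h%:P : mp m.+1) = ev m h.
Proof. by rewrite evS map_polyC hornerC. Qed.

Lemma evX m : ev m.+1 ('X : mp m.+1) = a m.
Proof. by rewrite evS map_polyX hornerX. Qed.

Lemma ev_cst n q : ev n (cst n q) = iota q.
Proof. by elim: n => // n IH; rewrite /cst -/cst evC. Qed.

Lemma ev_var n j : (j < n)%N -> ev n (var n j) = a j.
Proof.
elim: n => // n IH; rewrite ltnS leq_eqVlt /var -/var => /predU1P[->|ltj].
  by rewrite eqxx evX.
by rewrite ltn_eqF // evC IH.
Qed.

End Evaluation.

(** Uniqueness in the universal property of polynomial rings; the identities between substitutions
    and evaluations below follow from it. *)
Lemma ev_morph {B B' : comNzRingType} (g : {rmorphism B -> B'})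
  (iota : {rmorphism rat -> B}) (iota' : {rmorphism rat -> B'}) a a' n :
  (forall q, g (iota q) = iota' q) -> (forall j, (j < n)%N -> g (a j) = a' j) ->
  forall h, g (ev iota a n h) = ev iota' a' n h.
Proof.
move=> eq_iota; elim: n => [|n IH] eq_a h; first exact: eq_iota.
rewrite !evS -horner_map eq_a //; congr (_.[_]).
rewrite -map_poly_comp; apply: eq_map_poly => x /=.
by apply: IH => j ltj; apply: eq_a; apply: ltnW.
Qed.

Lemma eq_ev {B : comNzRingType} (iota : {rmorphism rat -> B}) a a' n :
  (forall j, (j < n)%N -> a j = a' j) -> forall h, ev iota a n h = ev iota a' n h.
Proof. by move=> eq_a h; apply: (ev_morph idfun). Qed.

Fixpoint cst_rmorph (n : nat) : {rmorphism rat -> mp n} :=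
  match n return {rmorphism rat -> mp n} with
  | 0 => idfun
  | m.+1 => GRing.RMorphism.clone _ _ (@polyC (mp m) \o cst_rmorph m) _
  end.

Lemma cst_rmorphE n : cst_rmorph n =1 cst n.
Proof. by elim: n => // n IH q; rewrite /= IH. Qed.

Lemma ev_id n (h : mp n) : ev (cst_rmorph n) (var n) n h = h.
Proof.
elim: n h => [//|n IH] h; rewrite evS /= eqxx.
transitivity (h \Po 'X : {poly mp n}); last exact: comp_polyXr.
congr (_.[_]); apply: eq_map_poly => x /=.
rewrite -[in RHS](IH x); symmetry; apply: (ev_morph (@polyC (mp n))) => //= j ltj.
by rewrite ltn_eqF.
Qed.

Lemma evalE (C : numClosedFieldType) (a : nat -> C) n (h : mp n) :
  eval a h = ev ratr a n h.
Proof.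
elim: n h => [//|n IH] h; rewrite evS (horner_coef_wide _ (size_poly _ _)) /=.
by apply: eq_bigr => i _; rewrite IH coef_map.
Qed.

Lemma eval_agree (C : numClosedFieldType) (a a' : nat -> C) n (h : mp n) :
  (forall j, (j < n)%N -> a j = a' j) -> eval a h = eval a' h.
Proof. by move=> eq_a; rewrite !evalE; apply: eq_ev. Qed.

(** Embeds [Q[y]] with [y] as the bottom variable, of index 0, so that the tower can be climbed from
    it; [mp 1] is [{poly rat}] by computation. *)
Fixpoint lift0var (k : nat) (t : {poly rat}) : mp k.+1 :=
  match k return mp k.+1 with 0 => t | m.+1 => (lift0var m t)%:P end.

Lemma ev_lift0var {B : comNzRingType} (iota : {rmorphism rat -> B}) a k t :
  ev iota a k.+1 (lift0var k t) = (map_poly iota t).[a 0%N].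
Proof. by elim: k => [//|k IH]; rewrite /lift0var -/lift0var evC. Qed.

(** [extend_point] trades [h] for an element [h0] one level down, outside the contracted prime;
    repeating this ends with [h1] in [Q[y]]. The point is then built upwards from [y], one
    coordinate per level. *)
Lemma extend_tower {C : numClosedFieldType} k (p : mp k.+1 -> Prop) : is_prime p ->
  forall h, ~ p h ->
  exists2 h1, ~ p (lift0var k h1) & forall y : C,
    (forall t, p (lift0var k t) -> (map_poly ratr t).[y] = 0) ->
    (map_poly ratr h1).[y] != 0 ->
    exists a, [/\ a 0%N = y, forall f, p f -> eval a f = 0 & eval a h != 0].
Proof.
elim: k p => [|k IH] p pP h nph.
  exists h => // y van nz; exists (fun=> y).
  have evy f : eval (fun=> y) (f : mp 1) = (map_poly ratr f).[y] by rewrite evalE.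
  by split=> // [f|]; rewrite evy //; apply: van.
have [h0 nph0 ext] := @extend_point (mp k.+1) p pP C h nph.
have [h1 nph1 ext1] := IH _ (contraction_prime p pP) h0 nph0.
exists h1 => // y van nz; have [a [a0 va nza]] := ext1 y van nz.
have [|//|c vc nzc] := ext (ev ratr a k.+1).
- by move=> r pr; rewrite -evalE; apply: va.
- by rewrite -evalE.
pose a' j := if j == k.+1 then c else a j.
have eva' f : eval a' (f : mp k.+2) = (map_poly (ev ratr a k.+1) f).[c].
  rewrite evalE evS {2}/a' eqxx; congr (_.[_]); apply: eq_map_poly.
  by apply: eq_ev => j ltj; rewrite /a' ltn_eqF.
exists a'; split; first by rewrite /a' /= a0.
  by move=> f pf; rewrite eva' vc.
by rewrite eva'.
Qed.

(** * Lifting a root to a zero of the system *)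

Lemma prime_preim {R S : comNzRingType} (g : {rmorphism R -> S}) (p : S -> Prop) :
  is_prime p -> is_prime (fun x => p (g x)).
Proof.
case=> pI p1 pM; split; [split|..].
- by rewrite rmorph0; apply: ideal0 pI.
- by move=> x y px py; rewrite rmorphD; apply: (idealD _ pI).
- by move=> x y py; rewrite rmorphM; apply: (idealM _ pI).
- by rewrite rmorph1.
- by move=> x y; rewrite rmorphM; apply: pM.
Qed.

(** Let [q] be a shortest nonzero element of [p]. Its gcd with [t] vanishes at [x0], so is
    nonconstant, and the cofactor in [q] is too short to be in [p]. By primality the gcd, hence [t],
    is in [p]. *)
Lemma prime_vanishing {C : numClosedFieldType} (p : {poly rat} -> Prop) (x0 : C) t0 :
  is_prime p -> p t0 -> t0 != 0 ->
  (forall t, p t -> root (map_poly ratr t) x0) ->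
  forall t, root (map_poly ratr t) x0 -> p t.
Proof.
move=> pP pt0 nz0 van t roott; have pI := prime_is_ideal _ pP.
have [q [pq nzq] qmin] := min_size (fun q => p q /\ q != 0) t0 (conj pt0 nz0).
have rootg : root (map_poly ratr (gcdp q t)) x0.
  by rewrite gcdp_map root_gcd van.
have nzg : gcdp q t != 0 by rewrite gcdp_eq0 negb_and nzq.
have /dvdpP[w qE] := dvdp_gcdl q t.
have pg : p (gcdp q t).
  move: (pq); rewrite {1}qE => /(primeM _ pP)[pw|//].
  have nzw : w != 0 by apply: contraNneq nzq => w0; rewrite qE w0 mul0r.
  have := qmin w (conj pw nzw); rewrite {1}qE size_mul //.
  have : (1 < size (gcdp q t))%N.
    by rewrite -(size_map_poly (ratr : rat -> C)); apply: root_size_gt1 rootg; rewrite map_poly_eq0.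
  case: (size (gcdp q t)) => [|[|m]] // _.
  by rewrite !addnS /= -addSn leqNgt ltnS leq_addr.
by have /dvdpP[v ->] := dvdp_gcdr q t; apply: (idealM _ pI).
Qed.

Lemma root_lifts_to_zero {C : numClosedFieldType} n (P : seq (mp n)) (u : mp n) (x0 : C) :
  zeroDim C P ->
  (forall t : {poly rat}, in_ideal predT (fun f => f \in P) (map_poly (cst n) t).[u] ->
     root (map_poly ratr t) x0) ->
  exists2 a, isZero P a & eval a u = x0.
Proof.
move=> [m [q zd]] van.
pose tu : {rmorphism mp 1 -> mp n} := ev (cst_rmorph n) (fun=> u) 1.
have tuE t : tu t = (map_poly (cst n) t).[u].
  by congr (_.[_]); apply: eq_map_poly; apply: cst_rmorphE.
(* The multiplicative set of all [t(u)] with [t(x0)] nonzero; [van] says that it misses the ideal of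
   the system. *)
pose M x := exists2 t, x = tu t & ~~ root (map_poly (ratr : rat -> C) t) x0.
have [||||p [pP Ip pM]] := @prime_avoiding _ (in_ideal predT (fun f => f \in P)) M.
- exact: in_ideal_is_ideal.
- by exists 1; rewrite ?rmorph1 // /root hornerC oner_eq0.
- move=> _ _ [t -> nzt] [t' -> nzt']; exists (t * t'); first by rewrite rmorphM.
  by rewrite rmorphM /= rootM negb_or nzt.
- by move=> _ /[swap] -[t -> /negP nzt]; rewrite tuE => /van.
have pI := prime_is_ideal _ pP.
(* [psi] substitutes [u] for the new bottom variable, and [sh] shifts the old variables up to make
   room for it. The tower is climbed for the preimage of [p] under [psi]. *)
pose psi : {rmorphism mp n.+1 -> mp n} :=
  ev (cst_rmorph n) (fun j => if j is j'.+1 then var n j' else u) n.+1.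
pose sh : {rmorphism mp n -> mp n.+1} :=
  ev (cst_rmorph n.+1) (fun j => var n.+1 j.+1) n.
have psi_sh f : psi (sh f) = f.
  rewrite -[RHS]ev_id; apply: ev_morph => [r|j ltj].
    by rewrite cst_rmorphE ev_cst.
  by rewrite ev_var.
have psi_lift t : psi (lift0var n t) = tu t by rewrite ev_lift0var.
have ev_sh (a : nat -> C) f : eval a (sh f) = eval (fun j => a j.+1) f.
  rewrite !evalE; apply: ev_morph => [r|j ltj]; last by rewrite ev_var.
  by rewrite cst_rmorphE ev_cst.
have [|h1 nph1 ext] := @extend_tower C n _ (prime_preim psi p pP) 1.
  by rewrite rmorph1; apply: prime1 pP.
have {}ext (y : C) : (forall t, p (tu t) -> (map_poly ratr t).[y] = 0) ->
    (map_poly ratr h1).[y] != 0 -> exists2 a, isZero P a & eval a u = y.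
  move=> vany nz; have [|//|a [a0 va _]] := ext y; first by move=> t; rewrite psi_lift; apply: vany.
  exists (fun j => a j.+1).
    move=> f fP; rewrite -ev_sh; apply: va; rewrite psi_sh.
    by apply: Ip; apply: in_ideal_gen.
  (* The kernel of [psi] contains [sh u] minus the bottom variable, so this difference vanishes at
     the point and [u] takes the value [y]. *)
  rewrite -ev_sh -a0 -(ev_var ratr a n.+1 0) // -evalE.
  apply/eqP; rewrite -subr_eq0 evalE [X in _ - X]evalE -rmorphB -evalE; apply/eqP; apply: va.
  by rewrite rmorphB psi_sh ev_var // subrr; apply: ideal0 pI.
rewrite psi_lift in nph1.
have [[t0 [pt0 nz0]]|qtriv] := pselect (exists t, p (tu t) /\ t != 0).
  have pvan t : p (tu t) -> root (map_poly ratr t) x0.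
    by move=> pt; apply: contrapT => /negP nz; apply: (pM _ pt); exists t.
  apply: ext => [t /pvan /rootP //|].
  (* If [h1] vanished at [x0], then [h1(u)] would be in [p]. *)
  apply/negP => /eqP/rootP rooth1; apply: nph1.
  exact: (prime_vanishing _ _ _ (prime_preim tu p pP) pt0 nz0 pvan).
(* Otherwise almost every value of [u] is attained on the finite zero set. *)
exfalso; pose w : {poly C} := map_poly ratr h1 * \prod_(k < m) ('X - (eval (q k) u)%:P).
have [|y nzy] := nonroot w.
  rewrite mulf_neq0 //; last by apply/prodf_neq0 => k _; rewrite polyXsubC_eq0.
  rewrite map_poly_eq0; apply: contra_notN nph1 => /eqP->.
  by rewrite rmorph0; apply: ideal0 pI.
move: nzy; rewrite hornerM mulf_eq0 negb_or => /andP[nz1 nz2].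
have [|//|a za ua] := ext y.
  move=> t pt; have -> : t = 0; last by rewrite rmorph0 horner0.
  by apply: contrapT => /eqP nz; apply: qtriv; exists t.
have [k ak] := zd a za; move: nz2.
rewrite horner_prod (bigD1 k) //= hornerXsubC -ua (eval_agree _ _ _ _ _ ak) subrr mul0r.
by rewrite eqxx.
Qed.

(** * The separating linear forms *)

Section OnlyIn.
Context (A : pred nat).

Lemma onlyIn0 n : @onlyIn A n 0.
Proof. by case: n => // n; rewrite /onlyIn /= size_poly0 orbT polyseq0. Qed.

Lemma onlyInP n (h : mp n.+1) :
  reflect ((A n || (size h <= 1)%N) /\ forall k, @onlyIn A n h`_k) (@onlyIn A n.+1 h).
Proof.
apply: (iffP andP) => -[sz coefs]; split=> //.
  move=> k; have [ltk|lek] := ltnP k (size h); last by rewrite nth_default ?onlyIn0.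
  by move/all_nthP: coefs; apply.
by apply/(all_nthP 0) => k _.
Qed.

Lemma onlyInC n (c : mp n) : @onlyIn A n.+1 c%:P = onlyIn A c.
Proof.
apply/onlyInP/idP => [[_ /(_ 0%N)]|Ac]; first by rewrite coefC.
split=> [|k]; first by rewrite size_polyC_leq1 orbT.
by rewrite coefC; case: eqP => // _; apply: onlyIn0.
Qed.

Lemma onlyInX n : A n -> @onlyIn A n.+1 'X.
Proof.
move=> An; apply/onlyInP; rewrite An; split=> // k; rewrite coefX.
case: (k == 1%N); last exact: onlyIn0.
by elim: n {An} => // n IH; rewrite -(polyC1 (mp n)) onlyInC.
Qed.

Lemma onlyIn_cst n q : onlyIn A (cst n q).
Proof. by elim: n => // n IH; rewrite /cst -/cst onlyInC. Qed.

Lemma onlyIn1 n : @onlyIn A n 1.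
Proof. by rewrite -(rmorph1 (cst_rmorph n)) cst_rmorphE onlyIn_cst. Qed.

Lemma onlyIn_var n j : A j -> onlyIn A (var n j).
Proof.
move=> Aj; elim: n => // n IH; rewrite /var -/var; case: eqP => [jn|_].
  by apply: onlyInX; rewrite -jn.
by rewrite onlyInC.
Qed.

Lemma onlyInD n (f g : mp n) : onlyIn A f -> onlyIn A g -> onlyIn A (f + g).
Proof.
elim: n f g => // n IH f g /onlyInP[szf cf] /onlyInP[szg cg]; apply/onlyInP.
split; last by move=> k; rewrite coefD; apply: IH.
case: (A n) szf szg => //= szf szg.
by rewrite (leq_trans (size_polyD _ _)) // geq_max szf.
Qed.

Lemma onlyInM n (f g : mp n) : onlyIn A f -> onlyIn A g -> onlyIn A (f * g).
Proof.
elim: n f g => // n IH f g /onlyInP[szf cf] /onlyInP[szg cg]; apply/onlyInP; split.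
  case: (A n) szf szg => //= szf szg.
  by rewrite (size1_polyC szf) (size1_polyC szg) -polyCM size_polyC_leq1.
move=> k; rewrite coefM; elim/big_ind: _ => [|x y|i _]; first exact: onlyIn0.
  exact: onlyInD.
exact: IH.
Qed.

Lemma onlyIn_horner n (t : {poly rat}) (u : mp n) :
  onlyIn A u -> onlyIn A (map_poly (cst_rmorph n) t).[u].
Proof.
move=> Au; elim/poly_ind: t => [|t c IH]; first by rewrite rmorph0 horner0 onlyIn0.
rewrite rmorphD rmorphM /= map_polyX map_polyC hornerMXaddC.
by apply: onlyInD; [apply: onlyInM | rewrite /= cst_rmorphE onlyIn_cst].
Qed.

End OnlyIn.

Lemma sub_onlyIn (A B : pred nat) n (f : mp n) :
  (forall j, A j -> B j) -> onlyIn A f -> onlyIn B f.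
Proof.
move=> sAB; elim: n f => // n IH f /onlyInP[szf cf]; apply/onlyInP; split.
  by case/orP: szf => [/sAB->//|->]; rewrite orbT.
by move=> k; apply: IH.
Qed.

(** This is [u_i]. As [sprod s j.+1] is the product of [s_1] to [s_j], it is the coefficient of the
    variable of index [j], that is [x_{j+1}]. *)
Definition sepForm (n : nat) (s : nat -> rat) (i : nat) : mp n :=
  \sum_(j < i) cst n (sprod s j.+1) * var n j.

Definition sepVal {C : numClosedFieldType} (s : nat -> rat) (i : nat) (a : nat -> C) : C :=
  \sum_(j < i) ratr (sprod s j.+1) * a j.

Section SeparatingForm.
Context (n : nat) (s : nat -> rat) (i : nat).
Hypothesis le_in : (i <= n)%N.

Lemma onlyIn_sepForm : onlyIn (fun j => (j < i)%N) (sepForm n s i).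
Proof.
rewrite /sepForm; elim/big_ind: _ => [|x y|j _]; [exact: onlyIn0|exact: onlyInD|].
by apply: onlyInM; [apply: onlyIn_cst|apply: onlyIn_var].
Qed.

Lemma eval_sepForm {C : numClosedFieldType} (a : nat -> C) :
  eval a (sepForm n s i) = sepVal s i a.
Proof.
rewrite evalE rmorph_sum; apply: eq_bigr => j _.
by rewrite rmorphM ev_cst ev_var // (leq_trans (ltn_ord j)).
Qed.

Lemma linFormE : linForm n s i = 'X - (sepForm n s i)%:P.
Proof.
rewrite /linForm /var -/var eqxx; congr (_ - _).
rewrite [RHS]rmorph_sum; apply: eq_bigr => j _.
by rewrite /= polyCM ltn_eqF // (leq_trans (ltn_ord j)).
Qed.

Lemma eq_map_cst t : map_poly (cst n) t = map_poly (cst_rmorph n) t.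
Proof. by apply: eq_map_poly => q; rewrite cst_rmorphE. Qed.

(** Write [t(x) = t(u) + w * (x - u)]: here [t(u)] involves only the first [i] variables, so it lies
    in the elimination ideal, and [w] involves only these and [x], as the coefficients in [Jideal]
    must. *)
Lemma Jideal_of_ideal (P : seq (mp n)) (t : {poly rat}) :
  in_ideal predT (fun f => f \in P) (map_poly (cst n) t).[sepForm n s i] ->
  Jideal P s i (map_poly (cst n) t).
Proof.
rewrite eq_map_cst => It; set u := sepForm n s i in It *.
pose B j := (j < i)%N || (j == n).
have Bn : B n by rewrite /B eqxx orbT.
have Bu : onlyIn B u.
  by apply: sub_onlyIn onlyIn_sepForm => j; rewrite /B => ->.
have [w Bw tE] : exists2 w : mp n.+1, onlyIn B w &
    map_poly (cst_rmorph n) t = (map_poly (cst_rmorph n) t).[u]%:P + w * ('X - u%:P).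
  elim/poly_ind: {It} t => [|t c [w Bw tE]].
    by exists 0; [apply: onlyIn0|rewrite rmorph0 horner0 mul0r addr0].
  (* Horner's rule for the quotient of [t(x) - t(u)] by [x - u]. *)
  exists (w * 'X + (map_poly (cst_rmorph n) t).[u]%:P).
    apply: onlyInD; first by apply: onlyInM => //; apply: onlyInX.
    by rewrite onlyInC; apply: onlyIn_horner.
  rewrite rmorphD rmorphM /= map_polyX map_polyC hornerMXaddC {1}tE polyCD polyCM /=.
  by ring.
exists 2, (fun k : 'I_2 => if k == ord0 then 1 else w),
  (fun k : 'I_2 => if k == ord0 then (map_poly (cst_rmorph n) t).[u]%:P else linForm n s i).
split; [|split].
- by move=> k; case: (k == ord0) => //; apply: onlyIn1.
- move=> k; case: (k == ord0); [left|by right].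
  exists (map_poly (cst_rmorph n) t).[u]; split=> //; split=> //.
  by apply: onlyIn_horner; apply: onlyIn_sepForm.
- by rewrite big_ord_recl big_ord1 /= mul1r linFormE.
Qed.

Lemma isZero_ideal {C : numClosedFieldType} {P : seq (mp n)} {a : nat -> C} {g : mp n} :
  isZero P a -> in_ideal predT (fun f => f \in P) g -> eval a g = 0.
Proof.
move=> za [m [h [f [_ [fP ->]]]]]; rewrite evalE rmorph_sum big1 // => k _.
by rewrite rmorphM -!evalE (za _ (fP k)) mulr0.
Qed.

(** Giving [x] the value of [u_i] at the zero makes every generator of [Jideal] vanish, hence also
    [T]. *)
Lemma root_of_zero {C : numClosedFieldType} (P : seq (mp n)) (T : {poly rat}) (a : nat -> C) :
  isGenT P s i T -> isZero P a -> root (map_poly ratr T) (sepVal s i a).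
Proof.
move=> gen za; set y := sepVal s i a.
have /gen [m [h [g [_ [gJ TE]]]]] := dvdpp T.
pose a' j := if j == n then y else a j.
have eva (f : mp n) : ev ratr a' n f = eval a f.
  by rewrite evalE; apply: eq_ev => j ltj; rewrite /a' ltn_eqF.
have evT : eval a' (map_poly (cst n) T : mp n.+1) = (map_poly ratr T).[y].
  rewrite evalE evS {2}/a' eqxx; congr (_.[_]).
  by rewrite eq_map_cst -map_poly_comp; apply: eq_map_poly => q /=; rewrite cst_rmorphE ev_cst.
rewrite rootE -evT TE evalE rmorph_sum big1 // => k _; rewrite rmorphM.
case: (gJ k) => [[g0 [[_ Ig0] ->]]|->].
  by rewrite evC eva (isZero_ideal za Ig0) mulr0.
rewrite linFormE rmorphB evX evC eva eval_sepForm.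
by rewrite /a' eqxx subrr mulr0.
Qed.

(** If [t(u_i)] is in the ideal of the system, then [t] is in [Jideal], so [T] divides [t] and [x]
    is a root of [t]: this is the hypothesis of [root_lifts_to_zero]. *)
Lemma zero_of_root {C : numClosedFieldType} (P : seq (mp n)) (T : {poly rat}) (x : C) :
  zeroDim C P -> isGenT P s i T -> root (map_poly ratr T) x ->
  exists2 a, isZero P a & sepVal s i a = x.
Proof.
move=> zd gen rootx.
have [t /Jideal_of_ideal/gen/dvdpP[v ->]|a za <-] :=
    root_lifts_to_zero n P (sepForm n s i) x zd.
  by rewrite rmorphM /= rootM rootx orbT.
by exists a; rewrite ?eval_sepForm.
Qed.

End SeparatingForm.

(** * The max norm and the separation of zeros *)

Section NormInf.
Context {C : numClosedFieldType}.
Implicit Types x y z : C.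

Lemma normInf_le x z : (normInf x <= z) = (`|'Re x| <= z) && (`|'Im x| <= z).
Proof. by rewrite /normInf comparable_ge_max // real_comparable ?normr_real. Qed.

Lemma normInf_ge0 x : 0 <= normInf x.
Proof.
have := lexx (normInf x); rewrite {1}normInf_le => /andP[re_le _].
exact: le_trans re_le.
Qed.

Lemma normInf_tri x y : normInf (x + y) <= normInf x + normInf y.
Proof.
have := lexx (normInf x); have := lexx (normInf y).
rewrite {1}normInf_le {1}(normInf_le x) => /andP[ry iy] /andP[rx ix].
by rewrite normInf_le !raddfD /= !(le_trans (ler_normD _ _)) ?lerD.
Qed.

Lemma normInfN x : normInf (- x) = normInf x.
Proof. by rewrite /normInf !raddfN /= !normrN. Qed.

Lemma normInf_scale (q : rat) x : 0 < q -> normInf (ratr q * x) = ratr q * normInf x.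
Proof.
rewrite -(ltr0q C); move: (ratr q) => c c0.
rewrite /normInf ReMl ?ImMl ?gtr0_real // !normrM gtr0_norm //.
by rewrite /Order.max ltr_pM2l //; case: (_ < _).
Qed.

End NormInf.

Lemma sprodS s i : (0 < i)%N -> sprod s i.+1 = sprod s i * s i.
Proof. by move=> i0; rewrite /sprod big_nat_recr. Qed.

Lemma sprod1 s : sprod s 1 = 1.
Proof. by rewrite /sprod big_geq. Qed.

Lemma sprod_gt0 n s i : (forall k, (1 <= k < n)%N -> 0 < s k) -> (i <= n)%N ->
  0 < sprod s i.
Proof.
move=> s_gt0 lein; rewrite /sprod big_nat; apply: prodr_gt0 => k /andP[k1 ki].
by apply: s_gt0; rewrite k1 (leq_trans ki).
Qed.

Lemma sepValS {C : numClosedFieldType} s i (a : nat -> C) :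
  sepVal s i.+1 a = sepVal s i a + ratr (sprod s i.+1) * a i.
Proof. by rewrite /sepVal big_ord_recr. Qed.

Lemma eq_sepVal {C : numClosedFieldType} s i (a b : nat -> C) :
  (forall j, (j < i)%N -> a j = b j) -> sepVal s i a = sepVal s i b.
Proof. by move=> ab; apply: eq_bigr => j _; rewrite ab. Qed.

(** Makes (C1) and (C2), which speak of the elimination ideals, available at zeros of the system. *)
Lemma isZero_inV {C : numClosedFieldType} n (P : seq (mp n)) i (a : nat -> C) :
  isZero P a -> inV P i a.
Proof. by move=> za g [_ Ig]; apply: isZero_ideal Ig. Qed.

Section Separation.
Context {C : numClosedFieldType} (n : nat) (P : seq (mp n)) (d r s : nat -> rat).
Hypothesis r_gt0 : forall i, (1 <= i <= n)%N -> 0 < r i.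
Hypothesis s_gt0 : forall i, (1 <= i < n)%N -> 0 < s i.
Hypothesis d_sep : forall i, (1 <= i <= n)%N -> forall a b : nat -> C,
  (i <> 1%N -> inV P i.-1 a) -> inV P i a -> inV P i b ->
  (forall j, (j < i.-1)%N -> a j = b j) -> a i.-1 != b i.-1 ->
  ratr (d i) < normInf (a i.-1 - b i.-1) / 2.
Hypothesis d_decr : forall i, (2 <= i <= n)%N -> d i < d i.-1 / (2 * s i.-1).
Hypothesis r_bound : forall i, (1 <= i <= n)%N ->
  forall a : nat -> C, inV P i a -> 2 * normInf (a i.-1) < ratr (r i).
Hypothesis s_le : forall i, (1 <= i < n)%N -> s i <= d i / r i.+1.

Let e i := sprod s i * d i.

(** (C2) bounds twice the norm of [x_{i+1}], stored as [a i], by [r_{i+1}], and (C3) gives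
    [s_i r_{i+1} <= d_i]. *)
Lemma tail_lt a i : isZero P a -> (1 <= i < n)%N ->
  normInf (ratr (sprod s i.+1) * a i) *+ 2 < ratr (e i) :> C.
Proof.
move=> za ilt; have /andP[i0 iltn] := ilt.
have sp := sprod_gt0 n s i s_gt0 (ltnW iltn).
have sp' := sprod_gt0 n s i.+1 s_gt0 iltn.
have rS := r_gt0 i.+1 iltn.
rewrite normInf_scale // -mulrnAr -mulr_natl.
have lt_r := r_bound i.+1 iltn a (isZero_inV _ _ _ _ za).
apply: (lt_le_trans (y := ratr (sprod s i.+1) * ratr (r i.+1))).
  by rewrite ltr_pM2l // ltr0q.
rewrite -rmorphM ler_rat sprodS // /e -mulrA ler_pM2l //.
by rewrite -ler_pdivlMr // s_le.
Qed.

Lemma scaled_d_decr i : (1 <= i < n)%N -> e i.+1 *+ 2 < e i.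
Proof.
move=> ilt; have /andP[i0 iltn] := ilt.
have sp := sprod_gt0 n s i s_gt0 (ltnW iltn).
rewrite /e sprodS // -mulrnAr -mulrA ltr_pM2l //.
have := d_decr i.+1; rewrite ltnS i0 iltn => /(_ isT) /=.
rewrite ltr_pdivlMr ?mulr_gt0 ?s_gt0 // => H.
by apply: le_lt_trans H; rewrite le_eqVlt; apply/orP; left; apply/eqP; ring.
Qed.

(** Induction on [i]. A gap above [2 e_i] loses less than [e_i] to the two new terms, and the rest
    exceeds [e_i > 2 e_{i+1}]. If the first difference is in the last coordinate, the gap is that
    difference scaled by [s_1...s_i], and [d_{i+1} < D_{i+1}] applies. *)
Lemma separation a b i : isZero P a -> isZero P b -> (i <= n)%N ->
  (exists2 j, (j < i)%N & a j != b j) ->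
  ratr (e i) *+ 2 < normInf (sepVal s i a - sepVal s i b) :> C.
Proof.
move=> za zb; elim: i => [|i IH] iltn; first by case.
have [[j ltj neq] _|agree [j]] := pselect (exists2 j, (j < i)%N & a j != b j).
  have i0 : (0 < i)%N by apply: leq_ltn_trans ltj.
  have ilt : (1 <= i < n)%N by rewrite i0.
  have {}IH := IH (ltnW iltn) (ex_intro2 _ _ j ltj neq).
  have ta := tail_lt a i za ilt; have tb := tail_lt b i zb ilt.
  have := scaled_d_decr i ilt; rewrite -(ltr_rat C) rmorphMn /= => lte.
  apply: (lt_trans lte); rewrite !sepValS.
  set x := sepVal s i a in IH *; set y := sepVal s i b in IH *.
  set v := _ * a i in ta *; set w := _ * b i in tb *.
  have tri : normInf (x - y) <= normInf (x + v - (y + w)) + (normInf v + normInf w).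
    have -> : x - y = (x + v - (y + w)) + (- v + w) by ring.
    apply: le_trans (normInf_tri _ _) _; rewrite lerD2l.
    by apply: le_trans (normInf_tri _ _) _; rewrite normInfN.
  have lt2 : normInf v + normInf w < ratr (e i).
    by rewrite -(ltr_pMn2r (n := 2)) // mulrnDl mulr2n ltrD.
  have := lt_le_trans IH tri; rewrite mulr2n => H.
  by rewrite -(ltrD2r (ratr (e i))) (lt_trans H) // ltrD2l.
have {}agree j' : (j' < i)%N -> a j' = b j'.
  by move=> lt; apply: contrapT => /eqP neq; apply: agree; exists j'.
rewrite ltnS leq_eqVlt => /predU1P[->|/agree->]; last by rewrite eqxx.
move=> neq; rewrite !sepValS (eq_sepVal _ _ _ _ agree) opprD addrACA subrr add0r -mulrBr.
have sp := sprod_gt0 n s i.+1 s_gt0 iltn.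
rewrite normInf_scale // rmorphM /= -mulrnAr ltr_pM2l ?ltr0q //.
have := d_sep i.+1 iltn a b (fun _ => isZero_inV _ _ _ _ za)
  (isZero_inV _ _ _ _ za) (isZero_inV _ _ _ _ zb) agree neq.
by rewrite ltr_pdivlMr // mulr_natr.
Qed.

(** Otherwise the values of [u_i] at [a] and [b] are more than [2 e_i] apart; but the distance is at
    most the sum of the assumed gap and the last term of [u_{i+1}] at [b], each below [e_i]. *)
Lemma neighbours_agree a b i : isZero P a -> isZero P b -> (1 <= i < n)%N ->
  normInf (sepVal s i.+1 b - sepVal s i a) < ratr (e i) :> C ->
  forall j, (j < i)%N -> a j = b j.
Proof.
move=> za zb ilt near j ltj; have /andP[i0 iltn] := ilt.
apply: contrapT => /eqP neq.
have := separation a b i za zb (ltnW iltn) (ex_intro2 _ _ j ltj neq).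
have tb := tail_lt b i zb ilt; rewrite sepValS in near.
set x := sepVal s i a in near *; set y := sepVal s i b in near *.
set w := _ * b i in tb near.
have w_lt : normInf w < ratr (e i).
  by apply: le_lt_trans tb; rewrite mulr2n lerDl normInf_ge0.
have -> : x - y = - (y + w - x) + w by ring.
move=> far; have := lt_le_trans far (normInf_tri _ _); rewrite normInfN mulr2n => far'.
by have := lt_trans far' (ltrD near w_lt); rewrite ltxx.
Qed.

End Separation.

(** * The roots of the LUR are the zeros of the system *)

Theorem mainTheorem1 (C : numClosedFieldType) (n : nat) (P : seq (mp n))
  (d r s : nat -> rat) (T : nat -> {poly rat}) :
  (0 < n)%N ->
  zeroDim C P ->
  (* positivity: d_1..d_n, r_1..r_n, s_1..s_{n-1} positive rationals *)
  (forall i, (1 <= i <= n)%N -> 0 < d i) ->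
  (forall i, (1 <= i <= n)%N -> 0 < r i) ->
  (forall i, (1 <= i < n)%N -> 0 < s i) ->
  (* (C1): d_i < D_i *)
  (forall i, (1 <= i <= n)%N ->
     forall a b : nat -> C,
       (i <> 1%N -> inV P i.-1 a) ->
       inV P i a -> inV P i b ->
       (forall j, (j < i.-1)%N -> a j = b j) ->
       a i.-1 != b i.-1 ->
       ratr (d i) < normInf (a i.-1 - b i.-1) / 2) ->
  (* (C1): d_i < d_{i-1} / (2 s_{i-1}) for i >= 2 (d_0 = +oo) *)
  (forall i, (2 <= i <= n)%N -> d i < d i.-1 / (2 * s i.-1)) ->
  (* (C2) *)
  (forall i, (1 <= i <= n)%N ->
     forall a : nat -> C, inV P i a -> 2 * normInf (a i.-1) < ratr (r i)) ->
  (* (C3) *)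
  (forall i, (1 <= i < n)%N -> s i <= d i / r i.+1) ->
  (* T_i generates (I_i ∪ {x - x_1 - s_1 x_2 - ... }) ∩ Q[x] *)
  (forall i, (1 <= i <= n)%N -> isGenT P s i (T i)) ->
  forall p : nat -> C, isLURroot n T s d p <-> isZero P p.
Proof.
move=> n_gt0 zd _ r_gt0 s_gt0 d_sep d_decr r_bound s_le gen p.
have sp_neq0 i : (i <= n)%N -> ratr (sprod s i) != 0 :> C.
  by move=> lein; rewrite gt_eqF // ltr0q (sprod_gt0 n).
split=> [[alpha [roots [near pE]]]|zp]; last first.
  (* For a zero [p], consecutive values of [u_i] differ by exactly the term bounded in [tail_lt],
     which also gives back the coordinates. *)
  exists (fun i => sepVal s i p); split; [|split] => [i ilt|i ilt|j].
  - by have /andP[_ lein] := ilt; apply: (root_of_zero n s i lein P) => //; apply: gen.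
  - rewrite sepValS [X in X - _]addrC addrK.
    apply: le_lt_trans (tail_lt n P d r s r_gt0 s_gt0 r_bound s_le p i zp ilt).
    by rewrite mulr2n lerDl normInf_ge0.
  case: j => // -[|j] /andP[_ lejn].
    by rewrite /= /sepVal big_ord1 sprod1 rmorph1 mul1r.
  by rewrite /= sepValS [X in X - _]addrC addrK mulrC mulKf // sp_neq0.
(* One zero [a i] above each [alpha i], with a dummy point outside the range of indices. *)
have /choice[a aP] i : exists a : nat -> C, (1 <= i <= n)%N ->
    isZero P a /\ sepVal s i a = alpha i.
  have [ilt|] := boolP (1 <= i <= n)%N; last by exists (fun=> 0).
  have /andP[_ lein] := ilt.
  have [b zb bE] := zero_of_root n s i lein P _ _ zd (gen i ilt) (roots i ilt).
  by exists b.
(* Induction on [m = n - i] passes agreement with [a n] from [a i.+1] down to [a i]. *)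
have agree_n m i : (1 <= i)%N -> (i + m)%N = n -> forall j, (j < i)%N -> a n j = a i j.
  elim: m i => [|m IH] i i0; first by rewrite addn0 => ->.
  rewrite addnS => imn j ltj; have iltn : (i < n)%N by rewrite -imn ltnS leq_addr.
  rewrite (IH i.+1) // 1?ltnW //.
  have [zi ai] : isZero P (a i) /\ sepVal s i (a i) = alpha i by apply: aP; rewrite i0 ltnW.
  have [zi' ai'] : isZero P (a i.+1) /\ sepVal s i.+1 (a i.+1) = alpha i.+1 by apply: aP.
  symmetry; apply: (neighbours_agree n P d r s r_gt0 s_gt0 d_sep d_decr r_bound s_le
    _ _ i zi zi') => //; first by rewrite i0.
  by rewrite ai ai'; apply: near; rewrite i0.
have val_n i : (1 <= i <= n)%N -> sepVal s i (a n) = alpha i.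
  move=> ilt; have /andP[i0 lein] := ilt; have [_ <-] := aP i ilt.
  by apply: eq_sepVal; apply: (agree_n (n - i)%N); rewrite ?subnKC.
have [zn _] : isZero P (a n) /\ sepVal s n (a n) = alpha n by apply: aP; rewrite n_gt0 leqnn.
move=> f fP; transitivity (eval (a n) f); last exact: zn.
(* The coordinates of [p] and of [a n] are recovered from the [alpha i] by the same formula, with
   the first coordinate treated apart. *)
apply: eval_agree => -[|j] ltj.
  by rewrite (pE 1%N) // -val_n // /sepVal big_ord1 sprod1 rmorph1 mul1r.
have -> : p j.+1 = (alpha j.+2 - alpha j.+1) / ratr (sprod s j.+2) by rewrite (pE j.+2 ltj).
have -> : alpha j.+2 = sepVal s j.+2 (a n) by rewrite val_n.
have -> : alpha j.+1 = sepVal s j.+1 (a n) by rewrite val_n //= ltnW.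
rewrite sepValS [X in X - _]addrC addrK mulrC mulKf; [by []|exact: sp_neq0].
Qed.
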